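(* Let $\Omega\subset\mathbb{R}^n$ be an arbitrary domain and let $p:\Omega\to\mathbb{R}$ be Borel-measurable with $1<p(x)<\infty$ for $x\in\Omega$. Then $(L^{p(\cdot)}(\Omega),\tau_{\rho_p})$ is Hausdorff. This includes the case $p^+=\operatorname{ess\,sup}_\Omega p=\infty$.
   Context: A domain is a nonempty connected open set. For measurable $u$ on $\Omega$ (functions equal a.e. being identified), $\rho_p(u)=\int_\Omega|u(x)|^{p(x)}\,dx\in[0,\infty]$, and $L^{p(\cdot)}(\Omega)=\{u:\rho_p(\lambda u)<\infty\text{ for some }\lambda>0\}$. For $u\in L^{p(\cdot)}(\Omega)$ and $\varepsilon>0$, $B_{\rho_p,\varepsilon}(u)=\{v\in L^{p(\cdot)}(\Omega):\rho_p(v-u)<\varepsilon\}$. The modular topology $\tau_{\rho_p}$: $A\subseteq L^{p(\cdot)}(\Omega)$ is open iff for every $u\in A$ there exists $\varepsilon>0$ with $B_{\rho_p,\varepsilon}(u)\subset A$. (The balls are not asserted to be open.) *)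

(* Defs.v *)
From HB Require Import structures.
From mathcomp Require Import all_boot all_order all_algebra.
From mathcomp Require Import all_classical all_reals all_analysis.
From mathcomp Require Import measurable_realfun.

Set Implicit Arguments.
Unset Strict Implicit.
Unset Printing Implicit Defensive.

Import Order.TTheory GRing.Theory Num.Theory.
Import numFieldNormedType.Exports.

Local Open Scope classical_set_scope.
Local Open Scope ring_scope.
Local Open Scope quotient_scope.

(* R^n (n >= 1) is represented by row vectors 'rV[R]_n.+1: the number [n] in
   this file is the dimension minus one. *)

Section lebesgue.
Context (R : realType) (n : nat).
Local Notation Rn := 'rV[R]_n.+1.

Definition box (ab : Rn * Rn) : set Rn :=
  [set x | forall i, ab.1 ord0 i < x ord0 i <= ab.2 ord0 i].

Definition box_volume (ab : Rn * Rn) : R :=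
  \prod_i Num.max 0 (ab.2 ord0 i - ab.1 ord0 i).

Definition box_cover (A : set Rn) : set (nat -> Rn * Rn) :=
  [set F | A `<=` \bigcup_k box (F k)].

Definition lebesgue_outer (A : set Rn) : \bar R :=
  ereal_inf
    [set (\sum_(0 <= k <oo) (box_volume (F k))%:E)%E | F in box_cover A].

Lemma box_volume_ge0 ab : 0 <= box_volume ab.
Proof. by apply: prodr_ge0 => i _; rewrite le_max lexx. Qed.

Let box_volumee_ge0 ab : (0 <= (box_volume ab)%:E)%E.
Proof. by rewrite lee_fin box_volume_ge0. Qed.

Lemma lebesgue_outer_ge0 A : (0 <= lebesgue_outer A)%E.
Proof.
by apply: le_ereal_inf_tmp => _ [F _ <-]; apply: nneseries_ge0 => k _ _.
Qed.

Lemma lebesgue_outer0 : lebesgue_outer set0 = 0%E.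
Proof.
apply/eqP; rewrite eq_le lebesgue_outer_ge0 andbT.
apply: ereal_inf_lbound; exists (fun=> (0, 0)); first exact: sub0set.
apply: eseries0 => k _ _; congr EFin.
by rewrite /box_volume big_ord_recl/= subrr maxxx mul0r.
Qed.

Lemma le_lebesgue_outer : {homo lebesgue_outer : A B / A `<=` B >-> (A <= B)%E}.
Proof.
move=> A B AB; apply: ereal_inf_le_tmp => _ [F BF <-].
by exists F => //; exact: subset_trans BF.
Qed.

Lemma lebesgue_outer_sigma_subadditive : sigma_subadditive lebesgue_outer.
Proof.
move=> A; have [[i ioo]|] := pselect (exists i, lebesgue_outer (A i) = +oo%E).
  rewrite (eseries_pinfty _ _ ioo) ?leey// => k _.
  by rewrite -ltNye (lt_le_trans _ (lebesgue_outer_ge0 _)).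
rewrite -forallNE => Aoo.
suff add2e (e : {posnum R}) : (lebesgue_outer (\bigcup_k A k) <=
    \sum_(i <oo) lebesgue_outer (A i) + e%:num%:E)%E.
  by apply/lee_addgt0Pr => _/posnumP[].
rewrite (le_trans _ (epsilon_trick _ _ _))//; last first.
  by move=> k; exact: lebesgue_outer_ge0.
pose P k (F : nat -> Rn * Rn) := box_cover (A k) F /\
  (\sum_(j <oo) (box_volume (F j))%:E <=
    lebesgue_outer (A k) + (e%:num / (2 ^ k.+1)%:R)%:E)%E.
have [G PG] : {G : nat -> nat -> Rn * Rn & forall k, P k (G k)}.
  apply: (@choice _ _ P) => k.
  have Ak : lebesgue_outer (A k) \is a fin_num.
    by rewrite ge0_fin_numE ?lebesgue_outer_ge0// ltey; exact/eqP.
  have en1 : (0 < e%:num / (2 ^ k.+1)%:R)%R by [].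
  have [_ [F AF <-] FA] := lb_ereal_inf_adherent en1 Ak.
  by exists F; split => //; exact/ltW.
pose v (ij : nat * nat) : \bar R := (box_volume (G ij.1 ij.2))%:E.
have v_ge0 x : (0 <= v x)%E by rewrite lee_fin box_volume_ge0.
apply: (@le_trans _ _ (\esum_(i in setT) v i)%E).
  apply: ereal_inf_lbound => /=.
  have /card_esym/ppcard_eqP[f] := card_nat2.
  exists (uncurry G \o f).
    move=> t [i _ /(PG i).1[j _ ?]]; exists (f^-1%FUN (i, j)) => //=.
    by rewrite invK ?inE.
  rewrite [LHS](_ : _ = \sum_(0 <= k <oo) v (f k))%E; last first.
    by apply: eq_eseriesr => k _; rewrite /v/=; case: (f k).
  rewrite -(esum_pred_image v _ xpredT) ?[fun=> _]set_true//.
  by rewrite image_eq.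
rewrite (_ : esum _ _ = \sum_(i <oo) \sum_(j <oo) v (i, j))%E; last first.
  pose J : nat -> set (nat * nat) := fun i => [set (i, j) | j in setT].
  rewrite (_ : setT = \bigcup_k J k); last first.
    by rewrite predeqE => -[a b]; split => // _; exists a => //; exists b.
  rewrite esum_bigcupT//=; last first.
    apply/trivIsetP => i j _ _ ij.
    rewrite predeqE => -[k m] /=; split => //= -[] [_] _ [<-{k} _].
    by move=> [m' _] [] /esym/eqP; rewrite (negbTE ij).
  rewrite -(image_id [set: nat]) -fun_true esum_pred_image//; last first.
    by move=> k _; exact: esum_ge0.
  apply: eq_eseriesr => /= j _.
  rewrite -(esum_pred_image v (pair j) predT)//=; last first.
    by move=> ? ? _ _; exact: (@can_inj _ _ _ snd).
  by congr esum; rewrite predeqE => -[a b]; split; move=> [i _ <-]; exists i.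
apply: lee_nneseries => k _; last exact: (PG k).2.
by move=> _; apply: nneseries_ge0 => j _ _; exact: v_ge0.
Qed.

HB.instance Definition _ := isOuterMeasure.Build R Rn lebesgue_outer
  lebesgue_outer0 lebesgue_outer_ge0 le_lebesgue_outer
  lebesgue_outer_sigma_subadditive.

(* R^n with the sigma-algebra of Lebesgue measurable sets *)
Definition lebesgue_space := caratheodory_type lebesgue_outer.
HB.instance Definition _ := Measurable.on lebesgue_space.

Definition lebesgue_rV : set lebesgue_space -> \bar R := lebesgue_outer.
HB.instance Definition _ := isMeasure.Build _ lebesgue_space R lebesgue_rV
  (@caratheodory_measure0 R Rn lebesgue_outer)
  (@caratheodory_measure_ge0 R Rn lebesgue_outer)
  (@caratheodory_measure_sigma_additive R Rn lebesgue_outer).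

Definition borel_space := g_sigma_algebraType (@open Rn).
HB.instance Definition _ := Measurable.on borel_space.

Definition is_domain (Omega : set Rn) : Prop :=
  [/\ Omega !=set0, open Omega & connected Omega].

End lebesgue.

Section variable_exponent.
Context (R : realType) (n : nat).
Local Notation Rn := (lebesgue_space R n).
Local Notation leb := (@lebesgue_rV R n).
Variables (Omega : set Rn) (p : Rn -> R).

Definition modular (u : Rn -> R) : \bar R :=
  (\int[leb]_(x in Omega) (`|u x| `^ p x)%:E)%E.

(* The next lemma makes the choice of representatives in [modular_ball]
   immaterial. *)
Lemma modular_ae_eq (u v : Rn -> R) :
  measurable Omega -> measurable_fun Omega p ->
  measurable_fun Omega u -> measurable_fun Omega v ->
  u = v %[ae leb in Omega] -> modular u = modular v.
Proof.
move=> mO mp.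
have mpow (w : Rn -> R) : measurable_fun Omega w ->
    measurable_fun Omega (EFin \o (fun x => `|w x| `^ p x)).
  move=> mw; apply/measurable_EFinP; rewrite /powR.
  have mnw : measurable_fun Omega (fun x => `|w x|) by exact: measurableT_comp.
  apply: measurable_fun_if => //=.
  - exact: measurable_fun_eqr.
  - apply: (measurable_funS mO) => //.
    apply: (@measurableT_comp _ _ _ _ _ _ (fun b : bool => b%:R : R)) => //.
    exact: measurable_fun_eqr.
  - apply: (measurable_funS mO) => //.
    apply: measurableT_comp => //; apply: measurable_funM => //.
    exact: measurableT_comp.
move=> mu mv uv.
apply: ge0_ae_eq_integral => //=; [exact: mpow|exact: mpow|].
by apply: filterS uv => x /[apply] ->.
Qed.

(* Functions are defined on all of R^n, but only their values on Omega matter: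
   two functions that agree a.e. on Omega are identified in Lp below. *)
Definition Lp_fun : set (Rn -> R) := [set u | measurable_fun Omega u /\
  exists2 lambda : R, 0 < lambda &
    (modular (fun x => lambda * u x)%R < +oo)%E].

Definition Lp_ae_eq (u v : Lp_fun) : bool :=
  `[< \val u = \val v %[ae leb in Omega] >].

Let Lp_ae_eq_refl : reflexive Lp_ae_eq.
Proof. by move=> u; apply/asboolP; exact: ae_eq_refl. Qed.

Let Lp_ae_eq_sym : symmetric Lp_ae_eq.
Proof.
by move=> u v; apply/idP/idP => /asboolP uv; apply/asboolP; exact: ae_eq_sym.
Qed.

Let Lp_ae_eq_trans : transitive Lp_ae_eq.
Proof.
by move=> v u w /asboolP uv /asboolP vw; apply/asboolP; exact: ae_eq_trans vw.
Qed.

Canonical Lp_ae_eq_equiv :=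
  EquivRel Lp_ae_eq Lp_ae_eq_refl Lp_ae_eq_sym Lp_ae_eq_trans.

Definition Lp : Type := {eq_quot Lp_ae_eq}.
HB.instance Definition _ := Choice.on Lp.
HB.instance Definition _ := EqQuotient.on Lp.

Definition Lp_repr (u : Lp) : Rn -> R := \val (repr u).

Definition modular_ball (u : Lp) (e : R) : set Lp :=
  [set v | (modular (Lp_repr v \- Lp_repr u)%R < e%:E)%E].

Definition modular_open : set_system Lp :=
  [set A | forall u, A u -> exists2 e : R, 0 < e & modular_ball u e `<=` A].

Let modular_openT : modular_open setT.
Proof. by move=> u _; exists 1. Qed.

Let modular_openI : setI_closed modular_open.
Proof.
move=> A B oA oB u [/oA[e e0 eA] /oB[f f0 fB]].
exists (Num.min e f); first by rewrite lt_min e0.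
move=> v; rewrite /modular_ball/= EFin_min lt_min => /andP[ve vf].
by split; [exact: eA|exact: fB].
Qed.

Let modular_open_bigcup (I : Type) (f : I -> set Lp) :
  (forall i, modular_open (f i)) -> modular_open (\bigcup_i f i).
Proof.
move=> of_ u [i _ /of_[e e0 ef]]; exists e => //.
by move=> v /ef fiv; exists i.
Qed.

HB.instance Definition _ := isOpenTopological.Build Lp
  modular_openT modular_openI modular_open_bigcup.

End variable_exponent.

(* Main.v *)
(** If [E] has finite measure and [p <= M] on [E], then for [0 < d <= 1] one has
    pointwise [t <= d + d^-1 `^ M * t `^ p x], so a small modular of [v - u]
    forces [\int_E |v - u|] to be small. By the triangle inequality the balls of
    the pseudometric [\int_E |v - u|] are therefore open in the modular topology
    (unlike, possibly, the modular balls). The sets where [p <= k], cut by the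
    cube of side [2 k], exhaust [Omega], so two distinct classes are at positive
    distance on one of them and disjoint balls separate them. *)

Require Import Defs.
From HB Require Import structures.
From mathcomp Require Import all_boot all_order all_algebra.
From mathcomp Require Import all_classical all_reals all_analysis.
From mathcomp Require Import measurable_realfun lra.
Import Order.TTheory GRing.Theory Num.Theory.
Import numFieldNormedType.Exports.
Local Open Scope classical_set_scope.
Local Open Scope ring_scope.

(** * Lebesgue measurability of boxes, open sets and Borel sets *)

Definition set_coord {R : realType} {n : nat} (i : 'I_n.+1) (a : R)
    (x : 'rV[R]_n.+1) : 'rV[R]_n.+1 :=
  \row_j (if j == i then a else x ord0 j).

(** The hyperplane [x_i = a] cuts the box into these two, and only the [i]-th side changes. Side
    lengths are truncated at 0, so they add up even if [a] misses the side or the box is empty. *)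
Lemma box_volume_cut {R : realType} {n : nat} (i : 'I_n.+1) (a : R)
    (ab : 'rV[R]_n.+1 * 'rV[R]_n.+1) :
  box_volume ab =
  box_volume (ab.1, set_coord i (Num.min (ab.2 ord0 i) a) ab.2) +
  box_volume (set_coord i (Num.max (ab.1 ord0 i) a) ab.1, ab.2).
Proof.
rewrite /box_volume !(bigD1 (P := xpredT) i)//= !mxE eqxx.
rewrite [X in _ = _ * X + _](eq_bigr
  (fun j => Num.max 0 (ab.2 ord0 j - ab.1 ord0 j))); last first.
  by move=> j /negPf ji; rewrite mxE ji.
rewrite [X in _ = _ + _ * X](eq_bigr
  (fun j => Num.max 0 (ab.2 ord0 j - ab.1 ord0 j))); last first.
  by move=> j /negPf ji; rewrite mxE ji.
rewrite -mulrDl; congr (_ * _).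
rewrite /Num.max /Num.min.
case: (ltP (ab.2 ord0 i) a) => ?; case: (ltP (ab.1 ord0 i) a) => ?;
  by do ![case: ltP => ?]; lra.
Qed.

(** Caratheodory's criterion: cutting each box of a cover of [X] at [a] gives a cover [G] of the
    part of [X] in [H] and a cover [K] of the rest, with the same total volume. *)
Lemma measurable_le_coord {R : realType} {n : nat} (i : 'I_n.+1) (a : R) :
  measurable ([set x | x ord0 i <= a] : set (lebesgue_space R n)).
Proof.
apply: le_caratheodory_measurable => X; set H := [set x | _].
apply: le_ereal_inf_tmp => _ [F XF <-].
pose G k := ((F k).1, set_coord i (Num.min ((F k).2 ord0 i) a) (F k).2).
pose K k := (set_coord i (Num.max ((F k).1 ord0 i) a) (F k).1, (F k).2).
rewrite (eq_eseriesr
  (g := fun k => (box_volume (G k))%:E + (box_volume (K k))%:E)%E); last first.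
  by move=> k _; rewrite -EFinD (box_volume_cut i a).
rewrite nneseriesD; [|by move=> k _ _; rewrite lee_fin box_volume_ge0..].
apply: leeD; apply: ereal_inf_lbound.
- exists G => // x [/XF[k _ Fx] Hx]; exists k => // j.
  rewrite !mxE /=; case: eqP => [->|_]; last exact: Fx.
  by have /andP[-> /= Fx2] := Fx i; rewrite le_min Fx2.
- exists K => // x [/XF[k _ Fx] /negP]; rewrite -ltNge => Hx; exists k => // j.
  rewrite !mxE /=; case: eqP => [->|_]; last exact: Fx.
  by have /andP[Fx1 ->] := Fx i; rewrite andbT gt_max Fx1.
Qed.

Lemma measurable_box {R : realType} {n : nat} (ab : 'rV[R]_n.+1 * 'rV[R]_n.+1) :
  measurable (box ab : set (lebesgue_space R n)).
Proof.
have -> : box ab = \bigcap_(i in [set: 'I_n.+1])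
    ([set x | x ord0 i <= ab.2 ord0 i] `\` [set x | x ord0 i <= ab.1 ord0 i]).
  apply/seteqP; split => [x abx i _|x abx i].
  - have /andP[abx1 abx2] := abx i.
    by split => //=; apply/negP; rewrite -ltNge.
  - by have [/= -> /negP] := abx i I; rewrite -ltNge => ->.
apply: fin_bigcap_measurable => // i _.
by apply: measurableD; exact: measurable_le_coord.
Qed.

Lemma lebesgue_box_fin {R : realType} {n : nat}
    (ab : 'rV[R]_n.+1 * 'rV[R]_n.+1) :
  (@lebesgue_rV R n (box ab) < +oo)%E.
Proof.
(* The box covers itself; the sequence is padded with degenerate boxes, whose volume is 0 because
   the dimension is at least 1. *)
pose F k := if k is 0%N then ab else (0 : 'rV[R]_n.+1, 0 : 'rV[R]_n.+1).
apply: (@le_lt_trans _ _ (\sum_(0 <= k <oo) (box_volume (F k))%:E)%E).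
  by apply: ereal_inf_lbound; exists F => // x abx; exists 0%N.
rewrite nneseries_recl//; last by move=> k _; rewrite lee_fin box_volume_ge0.
rewrite -nneseries_addn; last by move=> k; rewrite lee_fin box_volume_ge0.
rewrite eseries0 ?adde0 ?ltry// => k _ _; rewrite addn1 /=.
by rewrite /box_volume big_ord_recl /= subrr maxxx mul0r.
Qed.

(** An open set is the union of the boxes with rational corners that it contains, and there are only
    countably many of these. *)
Lemma open_measurable_lebesgue {R : realType} {n : nat} (U : set 'rV[R]_n.+1) :
  open U -> measurable (U : set (lebesgue_space R n)).
Proof.
move=> oU.
pose ratbox (q : 'rV[rat]_n.+1 * 'rV[rat]_n.+1) : set 'rV[R]_n.+1 :=
  box (map_mx ratr q.1, map_mx ratr q.2).
pose F q : set (lebesgue_space R n) :=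
  if `[< ratbox q `<=` U >] then ratbox q else set0.
have -> : U = \bigcup_q F q.
  apply/seteqP; split => [x Ux|x [q _]]; last first.
    by rewrite /F; case: asboolP => // qU; exact: qU.
  have /nbhs_ballP[e /= e0 xU] := oU _ Ux.
  (* Rational bounds strictly on either side of each coordinate, within [e]: the resulting box
     contains [x] and lies in the sup-norm ball of radius [e]. *)
  have h (i : 'I_n.+1) : {ab : rat * rat |
      (x ord0 i - e < ratr ab.1 < x ord0 i) /\
      (x ord0 i < ratr ab.2 < x ord0 i + e)}.
    have /rat_in_itvoo/cid[a] : x ord0 i - e < x ord0 i.
      by rewrite ltrBlDr ltrDl.
    have /rat_in_itvoo/cid[b] : x ord0 i < x ord0 i + e by rewrite ltrDl.
    by rewrite !in_itv/= => hb ha; exists (a, b).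
  pose q := (\row_i (sval (h i)).1, \row_i (sval (h i)).2).
  have Fx : ratbox q x.
    move=> i; rewrite /= !mxE; case: (h i) => [[a b]] /= [/andP[_ ->]].
    by move=> /andP[/ltW ->].
  exists q => //; rewrite /F; case: asboolP => // -[] y qy; apply: xU.
  split => // j i; rewrite (ord1 j); move: (qy i); rewrite /= !mxE.
  case: (h i) => [[a b]] /= [/andP[xa _]] /andP[_ bx] /andP[ay yb].
  by rewrite /ball /= ltr_distlC (lt_trans xa ay) (le_lt_trans yb bx).
apply: countable_bigcupT_measurable => [|q]; first exact: countableP.
by rewrite /F; case: asboolP => // _; exact: measurable_box.
Qed.

Lemma borel_measurable_lebesgue {R : realType} {n : nat} (A : set 'rV[R]_n.+1) :
  measurable (A : set (borel_space R n)) ->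
  measurable (A : set (lebesgue_space R n)).
Proof.
apply: smallest_sub A; first exact: sigma_algebra_measurable.
exact: open_measurable_lebesgue.
Qed.

(** * Bounding an integral of [|u|] by the modular *)

(** If [t <= d], the first term suffices. Otherwise [t / d > 1], so [t <= t / d] is at most the
    [q]-th power of [t / d]; since [d^-1 >= 1], the exponent of the factor [d^-1] may then be raised
    from [q] to [M]. *)
Lemma ler_add_powR {R : realType} (d t q M : R) :
  0 < d <= 1 -> 0 <= t -> 1 <= q <= M -> t <= d + d^-1 `^ M * t `^ q.
Proof.
move=> /andP[d0 d1] t0 /andP[q1 qM].
have [td|dt] := leP t d; first by rewrite ler_wpDr// mulr_ge0// powR_ge0.
rewrite ler_wpDl ?(ltW d0)//.
have dV1 : 1 <= d^-1 by rewrite invf_ge1.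
have tdV1 : 1 <= d^-1 * t by rewrite mulrC ler_pdivlMr// mul1r ltW.
apply: (@le_trans _ _ (d^-1 * t)); first by rewrite ler_peMl.
apply: (@le_trans _ _ ((d^-1 * t) `^ q)).
  by rewrite -[leLHS]powRr1 ?ler_powR// (le_trans _ tdV1).
rewrite powRM// ?invr_ge0 ?(ltW d0)//.
by rewrite ler_wpM2r ?powR_ge0// ler_powR.
Qed.

(** [powR] is defined by cases: at base 0 it is the indicator of a zero exponent, elsewhere the
    exponential of [p x * ln |u x|]. Both branches are measurable. *)
Lemma measurable_abs_powR {d} {T : measurableType d} {R : realType}
    (D : set T) (u p : T -> R) :
  measurable D -> measurable_fun D p -> measurable_fun D u ->
  measurable_fun D (fun x => (`|u x| `^ p x)%:E).
Proof.
move=> mD mp mu; apply/measurable_EFinP; rewrite /powR.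
have mnu : measurable_fun D (fun x => `|u x|) by exact: measurableT_comp.
apply: measurable_fun_if => //=.
- exact: measurable_fun_eqr.
- apply: (measurable_funS mD) => //.
  apply: (@measurableT_comp _ _ _ _ _ _ (fun b : bool => b%:R : R)) => //.
  exact: measurable_fun_eqr.
- apply: (measurable_funS mD) => //.
  apply: measurableT_comp => //; apply: measurable_funM => //.
  exact: measurableT_comp.
Qed.

Section integral_estimates.
Context {d} {T : measurableType d} {R : realType}.
Variable mu : {measure set T -> \bar R}.

(** The bound of [ler_add_powR] is integrated over [E]; the power term is nonnegative, so its domain
    may be enlarged to [D]. *)
Lemma integral_abs_le_powR (D E : set T) (p : T -> R) (M c : R) (u : T -> R) :
  measurable D -> measurable_fun D p -> measurable E -> E `<=` D ->
  (forall x, E x -> 1 <= p x <= M) ->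
  0 < c <= 1 -> measurable_fun D u ->
  (\int[mu]_(x in E) `|u x|%:E <=
   c%:E * mu E + (c^-1 `^ M)%:E * \int[mu]_(x in D) (`|u x| `^ p x)%:E)%E.
Proof.
move=> mD mp mE ED pM c01 mfu; have /andP[c0 _] := c01.
have mEu : measurable_fun E u by exact: measurable_funS ED mfu.
have mpow : measurable_fun E (fun x => (`|u x| `^ p x)%:E).
  by apply: measurable_funS ED _ => //; exact: measurable_abs_powR.
have mpowC : measurable_fun E (fun x => (c^-1 `^ M)%:E * (`|u x| `^ p x)%:E)%E.
  exact: measurable_funeM.
apply: (@le_trans _ _
    (\int[mu]_(x in E) (c%:E + (c^-1 `^ M)%:E * (`|u x| `^ p x)%:E))%E).
  apply: ge0_le_integral => //.
  - by apply/measurable_EFinP; exact: measurableT_comp.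
  - exact: emeasurable_funD.
  - by move=> x Ex; rewrite -EFinM -EFinD lee_fin ler_add_powR// pM.
rewrite ge0_integralD//; first last.
- by move=> x _; rewrite mule_ge0// lee_fin powR_ge0.
- by move=> x _; rewrite lee_fin ltW.
rewrite integral_cst//; apply: leeD2l; rewrite ge0_integralZl//; last first.
  by rewrite lee_fin powR_ge0.
apply: lee_wpmul2l; first by rewrite lee_fin powR_ge0.
by apply: ge0_subset_integral => //; exact: measurable_abs_powR.
Qed.

Lemma le_integral_dist (E : set T) (f g h : T -> R) : measurable E ->
  measurable_fun E f -> measurable_fun E g -> measurable_fun E h ->
  (\int[mu]_(x in E) `|f x - h x|%:E <=
   \int[mu]_(x in E) `|f x - g x|%:E + \int[mu]_(x in E) `|g x - h x|%:E)%E.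
Proof.
move=> mE mf mg mh.
have mdist (u v : T -> R) : measurable_fun E u -> measurable_fun E v ->
    measurable_fun E (fun x => `|u x - v x|%:E).
  move=> mu_ mv; apply/measurable_EFinP; apply: measurableT_comp => //.
  exact: measurable_funB.
rewrite -ge0_integralD//; [|exact: mdist..].
apply: ge0_le_integral => //; first exact: mdist.
  by apply: emeasurable_funD; exact: mdist.
by move=> x _; rewrite -EFinD lee_fin ler_distD.
Qed.

End integral_estimates.

(** * The L1 pseudometrics and the modular topology *)

Section modular_topology.
Context {R : realType} {n : nat}.
Local Notation Rn := (lebesgue_space R n).
Local Notation leb := (@lebesgue_rV R n).
Variables (Omega : set Rn) (p : Rn -> R).
Hypotheses (mO : measurable Omega) (mp : measurable_fun Omega p).

Lemma measurable_Lp_repr (u : Lp Omega p) : measurable_fun Omega (Lp_repr u).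
Proof. by have := valP (repr u); rewrite inE => -[]. Qed.

Lemma Lp_repr_ae_inj (u v : Lp Omega p) :
  Lp_repr u = Lp_repr v %[ae leb in Omega] -> u = v.
Proof.
by move=> uv; rewrite -[u]reprK -[v]reprK; apply/eqmodP/asboolP.
Qed.

(** Extended-real valued, so that it makes sense without first proving integrability on [E]. *)
Definition L1_dist (E : set Rn) (u v : Lp Omega p) : \bar R :=
  (\int[leb]_(x in E) `|Lp_repr u x - Lp_repr v x|%:E)%E.

Lemma L1_distC E u v : L1_dist E u v = L1_dist E v u.
Proof. by apply: eq_integral => x _; rewrite distrC. Qed.

Lemma L1_dist_triangle E u v w : measurable E -> E `<=` Omega ->
  (L1_dist E u w <= L1_dist E u v + L1_dist E v w)%E.
Proof.
move=> mE EO; apply: (le_integral_dist _ _ _ _ _ mE);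
  exact: measurable_funS mO EO (measurable_Lp_repr _).
Qed.

Lemma modular_open_L1_ball (E : set Rn) (M : R) (u : Lp Omega p) (r : R) :
  measurable E -> E `<=` Omega -> (leb E < +oo)%E ->
  (forall x, E x -> 1 <= p x <= M) ->
  modular_open [set v | (L1_dist E v u < r%:E)%E].
Proof.
move=> mE EO Efin pM v /= vur.
have d_ge0 : (0 <= L1_dist E v u)%E by exact: integral_ge0.
have dfin : L1_dist E v u \is a fin_num.
  by rewrite ge0_fin_numE// (lt_trans vur)// ltry.
have mEfin : leb E \is a fin_num by rewrite ge0_fin_numE.
move: vur; rewrite -(fineK dfin) lte_fin -subr_gt0.
(* The slack at [v]: by the triangle inequality it is enough that [L1_dist E w v < s]. *)
set s := r - _ => s0.
have m0 : 0 <= fine (leb E) by rewrite fine_ge0.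
(* Chosen so that [d * leb E <= s / 2]; the added 1 keeps the denominator positive when [E] is
   null. *)
pose d := Num.min 1 (s / 2 / (fine (leb E) + 1)).
have d0 : 0 < d by rewrite lt_min ltr01 !divr_gt0// ltr_wpDl.
have d01 : 0 < d <= 1 by rewrite d0 ge_min lexx.
pose C := d^-1 `^ M.
have C0 : 0 < C by rewrite powR_gt0 ?invr_gt0.
(* With this radius, [C] times the modular of [w - v] stays strictly below the other half of [s]. *)
exists (s / 2 / C); first by rewrite !divr_gt0.
move=> w; rewrite /modular_ball /= => wv.
apply: le_lt_trans (L1_dist_triangle E w v u mE EO) _.
rewrite -(fineK dfin) -lteBrDr//.
have mwv : measurable_fun Omega (Lp_repr w \- Lp_repr v).
  by apply: measurable_funB; exact: measurable_Lp_repr.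
apply: le_lt_trans
  (integral_abs_le_powR leb _ _ _ M d _ mO mp mE EO pM d01 mwv) _.
rewrite -EFinB -/s [s in ltRHS]splitr EFinD; apply: lee_ltD => //.
- by rewrite fin_numM.
- rewrite -[X in (_ * X)%E](fineK mEfin) -EFinM lee_fin.
  apply: (@le_trans _ _ (d * (fine (leb E) + 1))).
    by rewrite ler_pM2l// lerDl.
  by rewrite -ler_pdivlMr ?ltr_wpDl// ge_min lexx orbT.
- by rewrite muleC -lte_pdivlMr.
Qed.

(** If every distance vanished, the representatives would agree a.e. on each [E k]. A countable
    union of null sets is null, so they would agree a.e. on [Omega] and the classes would
    coincide. *)
Lemma exists_L1_dist_gt0 (E : nat -> set Rn) (u v : Lp Omega p) :
  (forall k, measurable (E k)) -> (forall k, E k `<=` Omega) ->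
  Omega `<=` \bigcup_k E k -> u != v ->
  exists k, (0 < L1_dist (E k) u v)%E.
Proof.
move=> mE EO OE; apply: contraNP => /forallNP h; apply/eqP/Lp_repr_ae_inj.
have ae0 k : {ae leb, forall x, E k x -> Lp_repr u x = Lp_repr v x}.
  have muv : measurable_fun (E k) (EFin \o (Lp_repr u \- Lp_repr v)).
    apply/measurable_EFinP; apply: measurable_funS (EO k) _ => //.
    by apply: measurable_funB; exact: measurable_Lp_repr.
  have /(ae_eq_integral_abs leb (mE k) muv) :
      (\int[leb]_(x in E k) `|(EFin \o (Lp_repr u \- Lp_repr v)%R) x| = 0)%E.
    apply/eqP; rewrite eq_le integral_ge0// andbT leNgt.
    exact/negP/h.
  apply: filterS => x /[apply] -[] /eqP; rewrite subr_eq0 => /eqP; exact.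
apply: filterS (ae_foralln ae0) => x uvx /OE[k _]; exact: uvx.
Qed.

End modular_topology.

Theorem theorem6p8 (R : realType) (n : nat) (Omega : set 'rV[R]_n.+1)
    (p : 'rV[R]_n.+1 -> R)
    (Omega_domain : is_domain Omega)
    (p_borel : measurable_fun (Omega : set (borel_space R n)) p)
    (p_gt1 : forall x, Omega x -> 1 < p x) :
  hausdorff_space (Lp Omega p).
Proof.
have [_ oO _] := Omega_domain.
have mO : measurable (Omega : set (lebesgue_space R n)).
  exact: open_measurable_lebesgue.
have mp : measurable_fun (Omega : set (lebesgue_space R n)) p.
  (* [Omega] is open, hence Borel, so the preimage of [Y] in [Omega] is Borel and therefore Lebesgue
     measurable. *)
  move=> _ Y mY; apply: borel_measurable_lebesgue; apply: p_borel => //.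
  exact: sub_sigma_algebra.
pose E (k : nat) : set (lebesgue_space R n) :=
  Omega `&` p @^-1` `]-oo, k%:R] `&` box (const_mx (- k%:R), const_mx k%:R).
have mE k : measurable (E k).
  by apply: measurableI; [exact: mp|exact: measurable_box].
have EO k : E k `<=` Omega by move=> x [[]].
have pE k x : E k x -> 1 <= p x <= k%:R.
  by move=> [[Ox]]; rewrite /= in_itv/= => -> _; rewrite ltW ?p_gt1.
have OE : Omega `<=` \bigcup_k E k.
  move=> x Ox.
  (* Bounding the sum makes one [k] dominate both the exponent and every coordinate. *)
  have [k xk] : exists k : nat, `|p x| + \sum_i `|x ord0 i| < k%:R.
    by exists (Num.truncn (`|p x| + \sum_i `|x ord0 i|)).+1; exact: truncnS_gt.
  have pk : `|p x| < k%:R.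
    by apply: le_lt_trans xk; rewrite lerDl sumr_ge0.
  exists k => //; split; first split => //=.
    by rewrite in_itv/= (le_trans (ler_norm _))// ltW.
  move=> i; rewrite /= !mxE.
  have : `|x ord0 i| < k%:R.
    apply: le_lt_trans xk; rewrite (bigD1 i)//= addrCA lerDl.
    by rewrite addr_ge0// sumr_ge0.
  by rewrite ltr_norml => /andP[-> /ltW].
have Efin k : (@lebesgue_rV R n (E k) < +oo)%E.
  apply: le_lt_trans (lebesgue_box_fin (const_mx (- k%:R), const_mx k%:R)).
  by apply: le_lebesgue_outer; exact: subIsetr.
(* Hausdorff in cluster form: [uv] says that every neighbourhood of [u] meets every neighbourhood of
   [v]. *)
move=> u v uv; apply: contrapT => /eqP.
move=> /(exists_L1_dist_gt0 Omega p mO E u v mE EO OE)[k d0].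
(* Half the distance if it is finite; any positive number, here 1, if it is infinite. *)
have [r r0 rd] : exists2 r : R, 0 < r &
    ((r + r)%:E <= L1_dist Omega p (E k) u v)%E.
  move: d0; case: (L1_dist _ _ _ _ _) => [d| |]//; last first.
    by exists 1 => //; rewrite leey.
  by rewrite lte_fin => d0; exists (d / 2); rewrite ?divr_gt0// -splitr.
pose B w := [set w' : Lp Omega p | (L1_dist Omega p (E k) w' w < r%:E)%E].
have nB w : nbhs w (B w).
  apply: open_nbhs_nbhs; split.
    exact: (modular_open_L1_ball Omega p mO mp (E k) k%:R w r (mE k) (EO k)
      (Efin k) (pE k)).
  rewrite /B /= /L1_dist; under eq_integral do rewrite subrr normr0.
  by rewrite integral0 lte_fin.
(* A common point [w] of the two balls would put [u] and [v] at distance less than [r + r]. *)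
have [w [/= wu wv]] := uv _ _ (nB u) (nB v).
have := lteD wu wv; apply/negP; rewrite -leNgt (le_trans rd)//.
by rewrite (L1_distC Omega p (E k) w u); exact: L1_dist_triangle.
Qed.
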